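(* Let $K\subset\mathbb{R}^m$ be a self-dual cone and let $\sqcap,\sqcup$ be the generalized lattice operations defined by $K$. The closed convex set $C\subset\mathbb{R}^m$ with nonempty interior is invariant with respect to the operations $\sqcap$ and $\sqcup$ if and only if it is of the form $$C=\bigcap_{i\in\mathbb{N}} H_-(u_i,a_i),$$ where each hyperplane $H(u_i,a_i)$ is tangent to $C$ and is invariant with respect to $\sqcap$ and $\sqcup$.
   Context: $\mathbb{R}^m$ carries the standard scalar product $\langle\cdot,\cdot\rangle$. A convex cone is a nonempty set $K$ with $K+K\subset K$ and $tK\subset K$ for all $t\ge 0$; it is self-dual if $K=K^*:=\{y\in\mathbb{R}^m:\langle x,y\rangle\ge 0\ \forall x\in K\}$. For a nonempty closed convex set $D$, $P_D x$ denotes the unique nearest point of $D$ to $x$. Generalized lattice operations: $x\sqcap y=P_{x-K}\,y$ and $x\sqcup y=P_{x+K}\,y$ for $x,y\in\mathbb{R}^m$. A set $M\subset\mathbb{R}^m$ is invariant with respect to $\sqcap$ and $\sqcup$ if $x,y\in M$ implies $x\sqcap y\in M$ and $x\sqcup y\in M$. For $u\neq 0$ and $a\in\mathbb{R}^m$: $H(u,a)=\{x\in\mathbb{R}^m:\langle u,x\rangle=\langle u,a\rangle\}$ and $H_-(u,a)=\{x\in\mathbb{R}^m:\langle u,x\rangle\le\langle u,a\rangle\}$. ''Tangent to $C$'' means tangent to $C$ at some point of the boundary of $C$.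
   Formalization: The family of halfspaces is indexed by an arbitrary, possibly empty, subset of N instead of all of N, since C = R^m is invariant but has no boundary and so no tangent hyperplane; for every other C the family can be re-indexed by all of N with repetitions. *)

(* Defs.v *)
From HB Require Import structures.
From mathcomp Require Import all_boot all_order all_algebra.
From mathcomp Require Import all_classical all_reals all_analysis.
Import Order.TTheory GRing.Theory Num.Theory.
Import numFieldNormedType.Exports.

Set Implicit Arguments.
Unset Strict Implicit.
Unset Printing Implicit Defensive.

Local Open Scope classical_set_scope.
Local Open Scope ring_scope.

(* The library norm on 'rV[R]_m is the sup norm, so the Euclidean norm is
   introduced separately; the library topology on 'rV[R]_m is the entrywise
   one, i.e., the usual topology of R^m. *)
Definition dot (R : realType) (m : nat) (x y : 'rV[R]_m) : R :=
  \sum_(i < m) x 0 i * y 0 i.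

Definition enorm (R : realType) (m : nat) (x : 'rV[R]_m) : R :=
  Num.sqrt (dot x x).

Definition convex_cone (R : realType) (m : nat) (K : set 'rV[R]_m) : Prop :=
  [/\ K !=set0,
      forall x y, K x -> K y -> K (x + y) &
      forall (t : R) x, 0 <= t -> K x -> K (t *: x)].

Definition dual_cone (R : realType) (m : nat) (K : set 'rV[R]_m) :
    set 'rV[R]_m :=
  [set y | forall x, K x -> 0 <= dot x y].

Definition self_dual_cone (R : realType) (m : nat) (K : set 'rV[R]_m) : Prop :=
  convex_cone K /\ K = dual_cone K.

Definition nearest_point (R : realType) (m : nat) (D : set 'rV[R]_m)
    (x p : 'rV[R]_m) : Prop :=
  D p /\ forall q, D q -> enorm (x - p) <= enorm (x - q).

(* Meaningful for D nonempty, closed and convex, where the nearest point exists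
   and is unique; the value 0 is a default for other sets. *)
Definition proj (R : realType) (m : nat) (D : set 'rV[R]_m)
    (x : 'rV[R]_m) : 'rV[R]_m :=
  xget 0 [set p | nearest_point D x p].

Definition gmeet (R : realType) (m : nat) (K : set 'rV[R]_m)
    (x y : 'rV[R]_m) : 'rV[R]_m :=
  proj [set x - k | k in K] y.

Definition gjoin (R : realType) (m : nat) (K : set 'rV[R]_m)
    (x y : 'rV[R]_m) : 'rV[R]_m :=
  proj [set x + k | k in K] y.

Definition lattice_invariant (R : realType) (m : nat)
    (K M : set 'rV[R]_m) : Prop :=
  forall x y, M x -> M y -> M (gmeet K x y) /\ M (gjoin K x y).

Definition hyperplane (R : realType) (m : nat) (u a : 'rV[R]_m) :
    set 'rV[R]_m :=
  [set x | dot u x = dot u a].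

Definition lower_halfspace (R : realType) (m : nat) (u a : 'rV[R]_m) :
    set 'rV[R]_m :=
  [set x | dot u x <= dot u a].

Definition boundary (R : realType) (m : nat) (C : set 'rV[R]_m) :
    set 'rV[R]_m :=
  closure C `\` C°.

(* No generality is lost by asking for C on the lower side: a hyperplane with C
   on its upper side is also H(- u, a). *)
Definition supporting_at (R : realType) (m : nat) (C : set 'rV[R]_m)
    (u a x : 'rV[R]_m) : Prop :=
  [/\ u != 0, hyperplane u a x & C `<=` lower_halfspace u a].

(* Tangency in the sense of convex analysis: H(u, a) is the unique supporting
   hyperplane of C at x. *)
Definition tangent_at (R : realType) (m : nat) (C : set 'rV[R]_m)
    (u a x : 'rV[R]_m) : Prop :=
  supporting_at C u a x /\
  forall v b, supporting_at C v b x -> hyperplane v b = hyperplane u a.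

Definition tangent_hyperplane (R : realType) (m : nat) (C : set 'rV[R]_m)
    (u a : 'rV[R]_m) : Prop :=
  exists2 x, boundary C x & tangent_at C u a x.

(* Main.v *)
Require Import Defs.
From HB Require Import structures.
From mathcomp Require Import all_boot all_order all_algebra.
From mathcomp Require Import all_classical all_reals all_analysis.
From mathcomp Require Import ring lra.
Import Order.TTheory GRing.Theory Num.Theory.
Import numFieldNormedType.Exports.
Local Open Scope classical_set_scope.
Local Open Scope ring_scope.

Set Implicit Arguments.
Unset Strict Implicit.
Unset Printing Implicit Defensive.

(* If x - y = p - q is the Moreau decomposition of x - y with respect to K, then
   the meet of x and y is x - p = y - q and their join is x + q = y + p.  Hence
   H(u, a) is invariant iff <u, p> and <u, q> never have the same strict sign
   for orthogonal p, q in K, and then the halfspace H_-(u, a) is invariant too;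
   this gives the "if" part.

   Conversely, let C be invariant.  At a boundary point x touched by a ball
   B(c, |x - c|) inside C, the hyperplane H(x - c, x) is the only supporting one
   and every direction pointing strictly into its lower side is feasible.  If
   p, q contradicted its invariance, then after rescaling q the small multiples
   of p/2 and q - p/2 (or their opposites) would lead from x into C, while the
   meet (or join) of the two points reached lies beyond the hyperplane.

   For z outside C and c0 interior to C, move the center of a small ball from c0
   to z while shrinking its radius linearly to 0.  When the ball first meets the
   complement of the interior of C, it touches the boundary, and the tangent
   hyperplane there excludes z.  Countably many of these halfspaces suffice by
   the Lindelof property. *)

(** * Euclidean geometry: scalar product, projections, compact balls *)

Section Dot.
Context {R : realType} {m : nat}.
Implicit Types (x y z : 'rV[R]_m) (t : R).

Lemma dotC x y : dot x y = dot y x.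
Proof. by apply: eq_bigr => i _; rewrite mulrC. Qed.

Lemma dotDl x y z : dot (x + y) z = dot x z + dot y z.
Proof. by rewrite -big_split; apply: eq_bigr => i _; rewrite mxE mulrDl. Qed.

Lemma dotZl t x y : dot (t *: x) y = t * dot x y.
Proof. by rewrite mulr_sumr; apply: eq_bigr => i _; rewrite mxE mulrA. Qed.

Lemma dotNl x y : dot (- x) y = - dot x y.
Proof. by rewrite -scaleN1r dotZl mulN1r. Qed.

Lemma dotDr x y z : dot x (y + z) = dot x y + dot x z.
Proof. by rewrite !(dotC x) dotDl. Qed.

Lemma dotZr t x y : dot x (t *: y) = t * dot x y.
Proof. by rewrite !(dotC x) dotZl. Qed.

Lemma dotNr x y : dot x (- y) = - dot x y.
Proof. by rewrite !(dotC x) dotNl. Qed.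

Definition dotE := (dotDl, dotDr, dotNl, dotNr, dotZl, dotZr).

Lemma dot_ge0 x : 0 <= dot x x.
Proof. by apply: sumr_ge0 => i _; rewrite -expr2 sqr_ge0. Qed.

Lemma sqr_coord_le_dot x i : x 0 i ^+ 2 <= dot x x.
Proof.
rewrite /dot (bigD1 i) //= -expr2 lerDl.
by apply: sumr_ge0 => j _; rewrite -expr2 sqr_ge0.
Qed.

Lemma dot_eq0 x : dot x x = 0 -> x = 0.
Proof.
move=> x0; apply/rowP => i; rewrite mxE; apply/eqP.
by rewrite -sqrf_eq0 eq_le sqr_ge0 -x0 sqr_coord_le_dot.
Qed.

Lemma dot_gt0 x : x != 0 -> 0 < dot x x.
Proof.
by move=> x0; rewrite lt_def dot_ge0 andbT; apply: contraNneq x0 => /dot_eq0 ->.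
Qed.

Lemma enorm_le x y : (enorm x <= enorm y) = (dot x x <= dot y y).
Proof. by rewrite ler_sqrt ?dot_ge0. Qed.

(** The extra term [dot (q - p) (q - p)] yields uniqueness as well as minimality, so the default
    value in [proj] never arises. *)
Lemma proj_eq (D : set 'rV[R]_m) x p : D p ->
  (forall q, D q ->
     dot (x - p) (x - p) + dot (q - p) (q - p) <= dot (x - q) (x - q)) ->
  Defs.proj D x = p.
Proof.
move=> Dp near_p; apply: xget_unique => /=.
  by split=> // q /near_p; rewrite enorm_le; move: (dot_ge0 (q - p)); lra.
move=> q [Dq /(_ _ Dp)]; rewrite enorm_le => qp.
apply/subr0_eq/dot_eq0; have := near_p _ Dq; have := dot_ge0 (q - p); lra.
Qed.

Lemma dot_continuous (T : topologicalType) (f g : T -> 'rV[R]_m) :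
  continuous f -> continuous g -> continuous (fun s => dot (f s) (g s)).
Proof.
move=> cf cg; apply: continuous_big; first exact: add_continuous.
move=> i _ s.
have coord (h : T -> 'rV[R]_m) : continuous h ->
    {for s, continuous (fun s => h s 0 i : R)}.
  move=> ch; apply: (@continuous_comp _ _ _ h (fun v : 'rV[R]_m => v 0 i)).
    exact: ch.
  exact: coord_continuous.
by apply: continuousM; exact: coord.
Qed.

Lemma dotr_continuous (u : 'rV[R]_m) : continuous (dot u).
Proof.
by apply: (@dot_continuous _ (cst u) id) => [|w A //]; exact: cst_continuous.
Qed.

Lemma sqdist_continuous (c : 'rV[R]_m) :
  continuous (fun x => dot (x - c) (x - c)).
Proof.
have cB : continuous (fun x : 'rV[R]_m => x - c).
  move=> x; apply: (@continuousB _ _ _ id (cst c) x) => //.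
  exact: cst_continuous.
exact: dot_continuous.
Qed.

Lemma closed_dot_ball (c : 'rV[R]_m) (r : R) :
  closed [set x | dot (x - c) (x - c) <= r].
Proof.
apply: (@preimage_closed _ _
  (fun x => dot (x - c) (x - c)) [set y : R | y <= r]).
  by move=> x _; exact: sqdist_continuous.
exact: closed_le.
Qed.

Lemma compact_dot_ball (c : 'rV[R]_m) (r : R) :
  compact [set x | dot (x - c) (x - c) <= r].
Proof.
have [r_ge0|r_lt0] := leP 0 r; last first.
  rewrite (_ : [set _ | _] = set0); first exact: compact0.
  by rewrite -subset0 => x /=; have := dot_ge0 (x - c); lra.
(* Here [r] bounds a squared distance; [r + 1] bounds its square root, hence each coordinate. *)
have box : compact
    [set v : 'rV[R]_m | forall i,
       v ord0 i \in `[c 0 i - (r + 1), c 0 i + (r + 1)]].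
  apply: (@rV_compact _ _
    (fun i => `[c 0 i - (r + 1), c 0 i + (r + 1)]%classic)).
  by move=> i; exact: segment_compact.
apply: (subclosed_compact _ box); first exact: closed_dot_ball.
move=> x /= xr i; have := le_trans (sqr_coord_le_dot (x - c) i) xr.
by rewrite !mxE /= in_itv /=; nra.
Qed.

End Dot.

(** The tool for first-order variations. The choice t = a / (a + |b| + |c|) gives t|b| + t|c| = a -
    ta < a. *)
Lemma small_quadratic (R : realFieldType) (a b c : R) : 0 < a ->
  exists2 t, 0 < t <= 1 & t * b + t ^+ 2 * c < a.
Proof.
move=> a0; have := normr_ge0 b; have := normr_ge0 c => c0 b0.
have d0 : 0 < a + `|b| + `|c| by lra.
pose t := a / (a + `|b| + `|c|); have t0 : 0 < t by rewrite divr_gt0.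
have td : t * (a + `|b| + `|c|) = a by rewrite mulfVK ?gt_eqF.
have t1 : t <= 1 by rewrite ler_pdivrMr // mul1r; lra.
exists t; first by rewrite t0.
have : t * b <= t * `|b| by rewrite ler_pM2l ?ler_norm.
have : t ^+ 2 * c <= t * `|c|.
  apply: (@le_trans _ _ (t ^+ 2 * `|c|)).
    by rewrite ler_wpM2l ?sqr_ge0 ?ler_norm.
  by rewrite ler_wpM2r // expr2 ler_piMl // ltW.
have : 0 < t * a by rewrite mulr_gt0.
lra.
Qed.

(** * Lattice operations of a self-dual cone via the Moreau decomposition *)

Section Cone.
Context {R : realType} {m : nat} (K : set 'rV[R]_m).
Hypothesis K_self_dual : self_dual_cone K.
Implicit Types (x y z p q k u a : 'rV[R]_m).

Let K_cone : convex_cone K. Proof. by case: K_self_dual. Qed.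

Lemma self_dual_ge0 p q : K p -> K q -> 0 <= dot p q.
Proof. by case: K_self_dual => _ KE Kp; rewrite {1}KE => /(_ p Kp). Qed.

Lemma self_dual_mem q : (forall k, K k -> 0 <= dot k q) -> K q.
Proof. by move=> Kq; case: K_self_dual => _ ->. Qed.

(** By orthogonality, the squared distance from y to x - k exceeds that to x - p by |p - k|^2 + 2<k,
    q>, where <k, q> >= 0 by self-duality. *)
Lemma gmeetE x y p q : K p -> K q -> dot p q = 0 -> x - y = p - q ->
  gmeet K x y = x - p.
Proof.
move=> Kp Kq pq xy; apply: proj_eq; first by exists p.
move=> _ [k Kk <-]; have := self_dual_ge0 Kk Kq.
have -> : y - (x - p) = q.
  by rewrite -[x](subrK y) xy; apply/rowP => i; rewrite !mxE; ring.
have -> : y - (x - k) = q + k - p.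
  by rewrite -[x](subrK y) xy; apply/rowP => i; rewrite !mxE; ring.
have -> : x - k - (x - p) = p - k by apply/rowP => i; rewrite !mxE; ring.
rewrite !dotE (dotC q k) (dotC q p) (dotC k p) pq; lra.
Qed.

Lemma gjoinE x y p q : K p -> K q -> dot p q = 0 -> y - x = p - q ->
  gjoin K x y = x + p.
Proof.
move=> Kp Kq pq xy; apply: proj_eq; first by exists p.
move=> _ [k Kk <-]; have := self_dual_ge0 Kk Kq.
have -> : y - (x + p) = - q.
  by rewrite -[y](subrK x) xy; apply/rowP => i; rewrite !mxE; ring.
have -> : y - (x + k) = p - q - k.
  by rewrite -[y](subrK x) xy; apply/rowP => i; rewrite !mxE; ring.
have -> : x + k - (x + p) = k - p by apply/rowP => i; rewrite !mxE; ring.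
rewrite !dotE (dotC q k) (dotC q p) (dotC k p) pq; lra.
Qed.

Lemma closed_self_dual : closed K.
Proof.
case: K_self_dual => _ ->.
have -> : dual_cone K = \bigcap_(k in K) [set y | 0 <= dot k y] by [].
apply: closed_bigI => k _.
apply: (@preimage_closed _ _ (dot k) [set r : R | 0 <= r]).
  by move=> y _; exact: dotr_continuous.
exact: closed_ge.
Qed.

(** Take p nearest to z in [K]; it exists by compactness of [D]. Comparing p with p + tk gives <k, p
    - z> >= 0, so q = p - z is in [K]; comparing it with (1 - t)p gives <p, q> <= 0. *)
Lemma moreau_decomposition z :
  exists p q, [/\ K p, K q, dot p q = 0 & z = p - q].
Proof.
case: K_cone => [[k0 Kk0] KD KZ].
have K0 : K 0 by rewrite -(scale0r k0); exact: KZ.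
pose D := [set x | dot (x - z) (x - z) <= dot z z] `&` K.
have [|||p] := @EVT_min_rV R m (fun x => dot (x - z) (x - z)) D.
- by exists 0; split => //=; rewrite sub0r !dotE opprK.
- by apply: compact_closedI; [exact: compact_dot_ball|exact: closed_self_dual].
- by apply: continuous_subspaceT; exact: sqdist_continuous.
rewrite inE => -[/= pz Kp] minD.
have minK k : K k -> dot (p - z) (p - z) <= dot (k - z) (k - z).
  move=> Kk; have [kz|/ltW] := leP (dot (k - z) (k - z)) (dot z z).
    by apply: minD; rewrite inE.
  exact: le_trans.
exists p, (p - z).
have pq k : K k -> 0 <= dot k (p - z).
  move=> Kk; rewrite leNgt; apply/negP; rewrite -oppr_gt0.
  move=> /(small_quadratic (dot k k / 2) 0) [t /andP[t0 _]].
  have := minK (p + t *: k) (KD _ _ Kp (KZ _ _ (ltW t0) Kk)).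
  rewrite !dotE (dotC p k) (dotC z k) (dotC z p); nra.
split=> //; first exact: self_dual_mem.
  apply/eqP; rewrite eq_le pq // andbT leNgt; apply/negP.
  move=> /(small_quadratic (dot p p / 2) 0) [t /andP[t0 t1]].
  have := minK _ (KZ (1 - t) p _ Kp); rewrite subr_ge0 => /(_ t1).
  rewrite !dotE (dotC z p); nra.
by apply/rowP => i; rewrite !mxE; ring.
Qed.

(* Rescaling q inside K makes p - q parallel to the hyperplanes orthogonal to u
   while keeping it a Moreau decomposition. *)
Lemma orthogonal_rescale u p q : K q -> dot p q = 0 -> 0 < dot u p * dot u q ->
  exists q', [/\ K q', dot p q' = 0 & dot u q' = dot u p].
Proof.
case: K_cone => _ _ KZ Kq pq upq.
have uq0 : dot u q != 0 by apply: contraTneq upq => ->; rewrite mulr0 ltxx.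
exists ((dot u p / dot u q) *: q); split; last by rewrite dotZr mulfVK.
  apply: KZ => //.
  have -> : dot u p / dot u q = dot u p * dot u q / dot u q ^+ 2 by field.
  by rewrite divr_ge0 ?sqr_ge0 // ltW.
by rewrite dotZr pq mulr0.
Qed.

Lemma lattice_invariant_hyperplaneP u a :
  lattice_invariant K (hyperplane u a) <->
  (forall p q, K p -> K q -> dot p q = 0 -> dot u p * dot u q <= 0).
Proof.
split=> [inv p q Kp Kq pq|pq0 x y].
  rewrite leNgt; apply/negP => upq.
  have [q' [Kq' pq' uq']] := orthogonal_rescale Kq pq upq.
  (* Both points lie on the hyperplane and differ by [p - q']; their meet [a - p] would lie off
     it. *)
  have [||] := inv a (a + q' - p).
  - by [].
  - by rewrite /hyperplane /= !dotE uq'; ring.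
  rewrite (gmeetE Kp Kq' pq').
    by rewrite /hyperplane /= !dotE => uap _; nra.
  by apply/rowP => i; rewrite !mxE; ring.
rewrite /hyperplane /= => xu yu.
have := moreau_decomposition (x - y) => -[p [q [Kp Kq pq xy]]].
have yx : y - x = q - p by rewrite -opprB xy opprB.
rewrite (gmeetE Kp Kq pq xy) (gjoinE Kq Kp _ yx); last by rewrite dotC.
have := pq0 _ _ Kp Kq pq.
(* Here <u, p> = <u, q>, so a product at most 0 forces both to vanish. *)
have := congr1 (dot u) xy; rewrite !dotE xu yu.
by move=> upq pqu; split; nra.
Qed.

(** If the meet x - p = y - q left the halfspace, <u, p> and <u, q> would both be negative; for the
    join x + q = y + p, both positive. *)
Lemma lattice_invariant_halfspace u a :
  lattice_invariant K (hyperplane u a) ->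
  lattice_invariant K (lower_halfspace u a).
Proof.
move=> /lattice_invariant_hyperplaneP pq0 x y xu yu.
have := moreau_decomposition (x - y) => -[p [q [Kp Kq pq xy]]].
have yx : y - x = q - p by rewrite -opprB xy opprB.
rewrite (gmeetE Kp Kq pq xy) (gjoinE Kq Kp _ yx); last by rewrite dotC.
have := pq0 _ _ Kp Kq pq.
have := congr1 (dot u) xy; move: xu yu; rewrite /lower_halfspace /= !dotE.
move=> xu yu xyu pqu.
split; rewrite leNgt; apply/negP; nra.
Qed.

End Cone.

(** * Boundary points touched by an inner ball *)

Section Convex.
Context {R : realType} {m : nat} (C : set 'rV[R]_m).
Implicit Types (c x y z p q k u a : 'rV[R]_m) (r s t : R).

Lemma interior_dot_ball (A : set 'rV[R]_m) x : A° x ->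
  exists2 r, 0 < r & forall y, dot (y - x) (y - x) <= r ^+ 2 -> A y.
Proof.
move=> /nbhs_ballP[e /= e0 eA]; exists (e / 2); first by rewrite divr_gt0.
move=> y yx; apply: eA; split=> // i j; rewrite (ord1 i).
have := le_trans (sqr_coord_le_dot (y - x) j) yx.
rewrite !mxE /ball /= => yxj; rewrite ltr_norml; nra.
Qed.

Lemma dot_ball_interior (A : set 'rV[R]_m) c x r :
  (forall y, dot (y - c) (y - c) < r -> A y) -> dot (x - c) (x - c) < r ->
  A° x.
Proof.
move=> rA; move: x.
suff : [set y | dot (y - c) (y - c) < r] `<=` A° by [].
rewrite -open_subsetE; first exact: rA.
apply: (@open_comp _ _ (fun y => dot (y - c) (y - c)) [set s : R | s < r]).
  by move=> y _; exact: sqdist_continuous.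
exact: open_lt.
Qed.

Hypothesis C_convex : convex_set C.

Lemma convex_comb x y t : C x -> C y -> 0 <= t <= 1 ->
  C (t *: x + (1 - t) *: y).
Proof.
move=> Cx Cy /andP[t0 t1].
by have := @C_convex x y (Itv01 t0 t1); rewrite !inE; exact.
Qed.

(* A point w beyond the tangent hyperplane would put x in the interior of the
   convex hull of w and the ball. *)
Lemma inner_ball_halfspace c x :
  (forall y, dot (y - c) (y - c) <= dot (x - c) (x - c) -> C y) -> ~ C° x ->
  C `<=` lower_halfspace (x - c) x.
Proof.
move=> ballC xC w Cw; rewrite /lower_halfspace /= leNgt; apply/negP => xw.
have xw0 : 0 < 2 * dot (x - c) (w - x).
  by rewrite mulr_gt0 // dotDr dotNr subr_gt0.
have [t /andP[t0 t1] ht] := small_quadratic (dot (w - x) (w - x)) 0 xw0.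
apply: xC; have t1_gt0 : 0 < 1 + t by lra.
have C' y : dot ((1 + t) *: y - t *: w - c) ((1 + t) *: y - t *: w - c) <=
            dot (x - c) (x - c) -> C y.
  move=> /ballC Cb; have -> : y =
      (t / (1 + t)) *: w + (1 - t / (1 + t)) *: ((1 + t) *: y - t *: w).
    by apply/rowP => i; rewrite !mxE; field; rewrite gt_eqF.
  apply: convex_comb => //.
  apply/andP; split; first by rewrite divr_ge0 // ltW.
  by rewrite ler_pdivrMr // mul1r; lra.
(* The homothety with center [w] and ratio 1/(1 + t) maps the ball to one centered at [b], whose
   open ball contains [x]. *)
pose b := (1 + t)^-1 *: (c + t *: w).
have bE y : dot ((1 + t) *: y - t *: w - c) ((1 + t) *: y - t *: w - c) =
            (1 + t) ^+ 2 * dot (y - b) (y - b).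
  have -> : (1 + t) *: y - t *: w - c = (1 + t) *: (y - b).
    by apply/rowP => i; rewrite !mxE; field; rewrite gt_eqF.
  by rewrite dotZl dotZr mulrA -expr2.
apply: (@dot_ball_interior C b x (dot (x - c) (x - c) / (1 + t) ^+ 2)).
  move=> y; rewrite ltr_pdivlMr ?exprn_gt0 // mulrC -bE => /ltW; exact: C'.
rewrite ltr_pdivlMr ?exprn_gt0 // mulrC -bE.
have -> : (1 + t) *: x - t *: w - c = x - c - t *: (w - x).
  by apply/rowP => i; rewrite !mxE; ring.
by move: (w - x) (x - c) ht => d n; rewrite !dotE (dotC d n); nra.
Qed.

Lemma inner_ball_tangent c x :
  (forall y, dot (y - c) (y - c) <= dot (x - c) (x - c) -> C y) -> ~ C° x ->
  x - c != 0 -> tangent_at C (x - c) x x.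
Proof.
move=> ballC xC n0; split; first by split=> //; exact: inner_ball_halfspace.
move=> v b [v0 xb Cv]; have xE : x = x - c + c by rewrite subrK.
move: (x - c) xE ballC n0 => n xE ballC n0.
have vv := dot_gt0 v0; pose l := dot v n / dot v v.
have lv : l * dot v v = dot v n by rewrite mulfVK ?gt_eqF.
(* l *: v has the same v-component as n and is shorter unless n = l *: v. *)
have nE : n = l *: v.
  apply/subr0_eq/dot_eq0/eqP; rewrite eq_le dot_ge0 andbT leNgt; apply/negP.
  move=> /(small_quadratic (2 * l * dot v v) (dot v v)) [t /andP[t0 t1] ht].
  (* A slightly larger l keeps the point in the ball but gives it a larger v-component than [x]
     has. *)
  have : C (c + (l + t) *: v).
    apply: ballC; rewrite addrC addKr.
    move: ht; rewrite !dotE (dotC n v) -lv; nra.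
  move=> /Cv; move: xb; rewrite /hyperplane /lower_halfspace /= => <-.
  rewrite xE !dotE -lv; nra.
have l0 : l != 0 by apply: contraNneq n0 => l0; rewrite nE l0 scale0r.
apply/seteqP; split=> y; rewrite /hyperplane /= in xb *; rewrite nE !dotZl -xb.
  by move=> ->.
by move=> /(mulfI l0).
Qed.

Lemma inner_ball_feasible c x d :
  (forall y, dot (y - c) (y - c) <= dot (x - c) (x - c) -> C y) ->
  dot (x - c) d < 0 ->
  exists2 s, 0 < s & forall t, 0 < t <= s -> C (x + t *: d).
Proof.
move=> ballC; rewrite -oppr_gt0 => xd.
have [s /andP[s0 _] hs] := small_quadratic (dot d d / 2) 0 xd.
exists s => // t /andP[t0 ts]; apply: ballC.
have -> : x + t *: d - c = x - c + t *: d by rewrite addrAC.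
have := dot_ge0 d; move: (x - c) hs => n; rewrite !dotE (dotC d n) => hs dd.
have : t * dot d d <= s * dot d d by rewrite ler_wpM2r.
nra.
Qed.

Lemma inner_ball_invariant (K : set 'rV[R]_m) c x :
  self_dual_cone K -> lattice_invariant K C ->
  (forall y, dot (y - c) (y - c) <= dot (x - c) (x - c) -> C y) -> ~ C° x ->
  lattice_invariant K (hyperplane (x - c) x).
Proof.
move=> K_self_dual C_inv ballC xC; have [[_ _ KZ] _] := K_self_dual.
have feas d := @inner_ball_feasible c x d ballC.
have := inner_ball_halfspace ballC xC.
move: (x - c) feas => u feas Cu.
apply/(lattice_invariant_hyperplaneP K_self_dual) => p q Kp Kq pq.
rewrite leNgt; apply/negP => upq.
have [q' [Kq' pq' uq']] := orthogonal_rescale K_self_dual Kq pq upq.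
have up0 : dot u p != 0 by apply: contraTneq upq => ->; rewrite mul0r ltxx.
case: (ltrgtP (dot u p) 0) up0 => // up0 _.
(* On both directions [u] takes the value <u, p>/2 < 0. Their difference is [p - q'], so the meet is
   x - sp/2, beyond the hyperplane. The other sign uses the opposite directions and the join. *)
- have [|s1 s10 h1] := feas (2^-1 *: p); first by rewrite dotZr; nra.
  have [|s2 s20 h2] := feas (q' - 2^-1 *: p).
    by rewrite dotDr dotNr dotZr uq'; nra.
  pose s := Num.min s1 s2; have s0 : 0 < s by rewrite lt_min s10.
  have [||+ _] := C_inv (x + s *: (2^-1 *: p)) (x + s *: (q' - 2^-1 *: p)).
  + by apply: h1; rewrite s0 ge_min lexx.
  + by apply: h2; rewrite s0 ge_min lexx orbT.
  rewrite (gmeetE K_self_dual (KZ s p (ltW s0) Kp) (KZ s q' (ltW s0) Kq')).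
  + by move=> /Cu; rewrite /lower_halfspace /= !dotE; nra.
  + by rewrite !dotE pq' !mulr0.
  + by apply/rowP => i; rewrite !mxE; field.
- have [|s1 s10 h1] := feas (- (2^-1 *: p)); first by rewrite dotNr dotZr; nra.
  have [|s2 s20 h2] := feas (2^-1 *: p - q').
    by rewrite dotDr dotNr dotZr uq'; nra.
  pose s := Num.min s1 s2; have s0 : 0 < s by rewrite lt_min s10.
  have [||_] := C_inv (x + s *: - (2^-1 *: p)) (x + s *: (2^-1 *: p - q')).
  + by apply: h1; rewrite s0 ge_min lexx.
  + by apply: h2; rewrite s0 ge_min lexx orbT.
  rewrite (gjoinE K_self_dual (KZ s p (ltW s0) Kp) (KZ s q' (ltW s0) Kq')).
  + by move=> /Cu; rewrite /lower_halfspace /= !dotE; nra.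
  + by rewrite !dotE pq' !mulr0.
  + by apply/rowP => i; rewrite !mxE; field.
Qed.

End Convex.

(** * Separating an outside point by a moving, shrinking ball *)

Section Touching.
Context {R : realType} {m : nat} (C : set 'rV[R]_m).
Hypotheses (C_closed : closed C) (C_convex : convex_set C).
Implicit Types (b c x y z : 'rV[R]_m) (r t : R).

Lemma segment_of_balls_continuous (T : topologicalType) (g : T -> R)
    (h : T -> 'rV[R]_m) c z r : continuous g -> continuous h ->
  continuous (fun s => c + g s *: (z - c) + ((1 - g s) * r) *: h s).
Proof.
move=> cg ch s; apply: cvgD; first apply: cvgD; first exact: cvg_cst.
  by apply: cvgZ; [exact: cg|exact: cvg_cst].
apply: cvgZ; last exact: ch.
by apply: cvgM; [apply: cvgB; [exact: cvg_cst|exact: cg]|exact: cvg_cst].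
Qed.

Lemma inner_ball_exclusion c0 z : C° c0 -> ~ C z ->
  exists c x,
    [/\ forall y, dot (y - c) (y - c) <= dot (x - c) (x - c) -> C y,
        ~ C° x, x - c != 0 & dot (x - c) x < dot (x - c) z].
Proof.
move=> c0C zC.
have : (C°)° c0 by have /interior_id -> := @open_interior _ C.
move=> /interior_dot_ball [r2 r20 r2C].
pose r := r2 / 2; have r0 : 0 < r by rewrite divr_gt0.
have r2E : r2 = 2 * r by rewrite /r; field.
(* For fixed time s, [f (s, b)] with b in [B] runs over the moving ball. The least time in [E] is
   that of first contact. *)
pose f (s : R * 'rV[R]_m) := c0 + s.1 *: (z - c0) + ((1 - s.1) * r) *: s.2.
pose B : set 'rV[R]_m := [set b | dot (b - 0) (b - 0) <= 1].
pose E := (`[0, 1] `*` B) `&` f @^-1` (~` C°).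
have [|||[t b]] := @compact_EVT_min _ R fst E.
- exists (1, 0); split.
    split=> /=; first by rewrite in_itv /= lexx ler01.
    by rewrite /B /= subr0 -(scale0r 0) dotZl mul0r.
  rewrite /f /= subrr mul0r !scale0r addr0 scale1r addrC subrK.
  by move=> /interior_subset.
- apply: compact_closedI.
    by apply: compact_setX; [exact: segment_compact|exact: compact_dot_ball].
  apply: preimage_closed; first move=> s _.
    by apply: segment_of_balls_continuous => w; [exact: cvg_fst|exact: cvg_snd].
  by apply: open_closedC; exact: open_interior.
- by apply: continuous_subspaceT => s; exact: cvg_fst.
rewrite inE => -[[/= + Bb] fC] minE; rewrite in_itv /= => /andP[t0 t1].
have bb1 : dot b b <= 1 by move: Bb; rewrite /B /= subr0.
have inC s e : 0 <= s < t -> B e -> C° (f (s, e)).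
  move=> /andP[s0 st] Be; apply: contrapT => sC.
  have /minE /= : (s, e) \in E.
    by rewrite inE; split=> //; split=> //=; rewrite in_itv /= s0; lra.
  by rewrite leNgt st.
have tgt0 : 0 < t.
  rewrite lt_def t0 andbT; apply/eqP => t00; apply: fC; apply: r2C.
  have -> : f (t, b) - c0 = r *: b.
    by apply/rowP => i; rewrite /f /= t00 !mxE; ring.
  rewrite r2E dotZl dotZr mulrA -expr2.
  have : r ^+ 2 * dot b b <= r ^+ 2 by rewrite ger_pMr // exprn_gt0.
  by have := sqr_ge0 r; nra.
(* At contact the whole ball lies in [C], as a limit of balls at earlier times. *)
have tC e : B e -> C (f (t, e)).
  move=> Be; have clA : closed [set s | C (f (s, e))].
    apply: (@preimage_closed _ _ (fun s => f (s, e))) => // s _.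
    apply: (@segment_of_balls_continuous _ id (cst e) c0 z r).
      by move=> w A.
    exact: cst_continuous.
  apply: clA => N /nbhs_ballP [d /= d0 dN].
  pose s := Num.max 0 (t - d / 2); have st : 0 <= s < t.
    by rewrite le_max lexx gt_max tgt0 /=; lra.
  exists s; split; first exact: (interior_subset (inC _ _ st Be)).
  apply: dN; rewrite /ball /= ltr_norml.
  have : t - d / 2 <= s by rewrite le_max lexx orbT.
  by move: st => /andP[_ st] ds; lra.
have tlt1 : t < 1.
  rewrite lt_def t1 andbT eq_sym; apply/eqP => t11; apply: zC.
  have := tC b Bb; rewrite /f /= t11 subrr mul0r scale0r addr0 scale1r.
  by rewrite addrC subrK.
pose rho := (1 - t) * r; have rho0 : 0 < rho by rewrite mulr_gt0 ?subr_gt0.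
pose c := c0 + t *: (z - c0).
have fE e : f (t, e) = c + rho *: e by [].
have ballC y : dot (y - c) (y - c) <= rho ^+ 2 -> C y.
  move=> yc; have -> : y = f (t, rho^-1 *: (y - c)).
    by rewrite fE scalerA divff ?gt_eqF // scale1r addrC subrK.
  by apply: tC; rewrite /B /= subr0 dotZl dotZr mulrA -expr2 exprVn mulrC
    ler_pdivrMr ?exprn_gt0 // mul1r.
have bb : dot b b = 1.
  move: bb1; rewrite le_eqVlt => /orP[/eqP //|b1]; exfalso; apply: fC.
  apply: (@dot_ball_interior _ _ _ c _ (rho ^+ 2)).
    by move=> y /ltW; exact: ballC.
  rewrite fE addrC addKr dotZl dotZr mulrA -expr2 gtr_pMr ?exprn_gt0 //.
have xcE : f (t, b) - c = rho *: b by rewrite fE addrC addKr.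
have ballC' y : dot (y - c) (y - c) <= dot (f (t, b) - c) (f (t, b) - c) -> C y.
  by rewrite xcE dotZl dotZr bb mulr1 -expr2; exact: ballC.
exists c, (f (t, b)); split=> //.
  rewrite xcE scaler_eq0 gt_eqF //=; apply/eqP => b0.
  by move: bb; rewrite b0 -(scale0r 0) dotZl mul0r; lra.
(* Since r2 = 2r, the halfspace at the contact point gives t<b, z - c0> >= (1 + t)r, hence <b, z -
   c0> > r, which excludes [z] strictly. *)
have : C (c0 + r2 *: b).
  apply: interior_subset; apply: r2C; rewrite addrC addKr dotZl dotZr bb; lra.
move=> /(inner_ball_halfspace C_convex ballC' fC).
rewrite /lower_halfspace /= xcE !dotZl !ler_pM2l // ltr_pM2l //.
rewrite /f /= !dotE bb r2E; nra.
Qed.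

End Touching.

(** * Countable intersections and the theorem *)

(* Lindelof: a halfspace is picked for each box with rational center and radius
   1/(k+1) that some halfspace of the family misses. *)
Lemma countable_halfspaces (R : realType) (m : nat) (C : set 'rV[R]_m)
    (P : 'rV[R]_m * 'rV[R]_m -> Prop) :
  (forall h, P h -> C `<=` lower_halfspace h.1 h.2) ->
  (forall z, ~ C z -> exists2 h, P h & ~ lower_halfspace h.1 h.2 z) ->
  exists (I : set nat) (h : nat -> 'rV[R]_m * 'rV[R]_m),
    C = \bigcap_(i in I) lower_halfspace (h i).1 (h i).2 /\
    (forall i, I i -> P (h i)).
Proof.
move=> PC sepC.
pose box (b : 'rV[rat]_m * nat) : set 'rV[R]_m :=
  [set y | forall i, `|y 0 i - ratr (b.1 0 i)| < b.2.+1%:R^-1].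
pose good n h := P h /\ exists2 b, unpickle n = Some b &
  box b `<=` ~` lower_halfspace h.1 h.2.
have /choice [h hgood] n : exists h, (exists h', good n h') -> good n h.
  have [[h' gh']|ng] := pselect (exists h', good n h'); first by exists h'.
  by exists (0, 0).
exists [set n | exists h', good n h'], h; split; last by move=> n /hgood [].
apply/seteqP; split=> [y Cy n /hgood [Ph _]|z zI]; first exact: (PC _ Ph).
apply: contrapT => /sepC [[u a] Pua zua].
have : nbhs z (~` lower_halfspace u a).
  apply: open_nbhs_nbhs; split=> //; apply: closed_openC.
  apply: (@preimage_closed _ _ (dot u) [set r : R | r <= dot u a]).
    by move=> y _; exact: dotr_continuous.
  exact: closed_le.
move=> /nbhs_ballP [e /= e0 eP].
have e2 : 0 < e / 2 by rewrite divr_gt0.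
have [k] := ltr_add_invr e2; rewrite add0r => ke.
have k0 : 0 < k.+1%:R^-1 :> R by rewrite invr_gt0.
have /choice [q qz] i : exists q : rat, `|z 0 i - ratr q| < k.+1%:R^-1.
  move: (k.+1%:R^-1) k0 => d d0.
  have : z 0 i - d < z 0 i + d by lra.
  move=> /rat_in_itvoo [q]; rewrite in_itv /= => /andP[q1 q2]; exists q.
  by rewrite ltr_norml; lra.
pose b : 'rV[rat]_m * nat := (\row_i q i, k).
have boxz : box b z by move=> i; rewrite mxE.
have gn : exists h', good (pickle b) h'.
  exists (u, a); split=> //; exists b; first exact: pickleK.
  move=> y yb; apply: eP; split=> // i j; rewrite (ord1 i) /ball /=.
  have := yb j; have := boxz j; rewrite /=.
  by move: (k.+1%:R^-1) ke => d ke; rewrite !ltr_norml; lra.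
(* The halfspace chosen for this box may differ from that of (u, a), but it also misses the box,
   hence [z]. *)
have [_ [b' ]] := hgood _ gn; rewrite pickleK => -[<-] /(_ _ boxz); apply.
exact: zI.
Qed.

Theorem theorem1 (R : realType) (m : nat) (K C : set 'rV[R]_m)
    (K_self_dual : self_dual_cone K)
    (C_closed : closed C) (C_convex : convex_set C)
    (C_interior : C° !=set0) :
  lattice_invariant K C <->
  exists (I : set nat) (u a : nat -> 'rV[R]_m),
    C = \bigcap_(i in I) lower_halfspace (u i) (a i) /\
    (forall i, I i -> tangent_hyperplane C (u i) (a i) /\
                      lattice_invariant K (hyperplane (u i) (a i))).
Proof.
split=> [C_inv|[I [u [a [CE uaP]]]] x y].
  have [|z zC|I [h [CE hP]]] := @countable_halfspaces R m C
    (fun h => tangent_hyperplane C h.1 h.2 /\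
              lattice_invariant K (hyperplane h.1 h.2)).
  - by move=> h [[x _ [[_ _ Ch] _]] _].
  - have [c0 c0C] := C_interior.
    have [c [x [ballC xC n0 xz]]] :=
      inner_ball_exclusion C_closed C_convex c0C zC.
    exists (x - c, x); last by rewrite /lower_halfspace /= leNgt xz.
    split; last exact: (inner_ball_invariant C_convex).
    exists x; last exact: (inner_ball_tangent C_convex).
    by split=> //; apply: subset_closure; exact: ballC.
  - by exists I, (fst \o h), (snd \o h).
rewrite CE => Cx Cy; split=> i Ii;
  have [_ /(lattice_invariant_halfspace K_self_dual) inv] := uaP i Ii;
  by have [] := inv x y (Cx i Ii) (Cy i Ii).
Qed.
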